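(* Let $(\hat X,\hat T)$ be a two-sided topological Markov shift (possibly with countable alphabet), let $(X,T)$ be the one-sided topological Markov shift with the same alphabet and transition matrix, and let $\pi:\hat X\to X$ be the natural projection. Let $\hat f\in C(\hat X)$ satisfy the (two-sided) Walters condition with $\mathrm{var}_1\hat f<\infty$. Then there exist a function $f:X\to\mathbb R$ which satisfies the (one-sided) Walters condition and a bounded, uniformly continuous function $h:\hat X\to\mathbb R$ such that $\hat f+h-h\circ\hat T=f\circ\pi$.
   Context: Shifts: let $S$ be a finite or countable alphabet and $A=(A_{ab})_{a,b\in S}$ a matrix with entries in $\{0,1\}$. The one-sided topological Markov shift (TMS) is $X=\{x\in S^{\mathbb N}:A_{x_ix_{i+1}}=1\ \forall i\ge 0\}$ (indices start at $0$) with $T(x_0,x_1,x_2,\dots)=(x_1,x_2,\dots)$; the two-sided TMS is $\hat X=\{\hat x\in S^{\mathbb Z}:A_{x_ix_{i+1}}=1\ \forall i\in\mathbb Z\}$ with the left shift $\hat T$. Both carry the product topology induced by the discrete topology on $S$, metrized by $d(x,y)=\exp(-\min\{|i|:x_i\ne y_i\})$. $C(\cdot)$ denotes real-valued continuous functions. Natural projection: $\pi((x_i)_{i=-\infty}^\infty)=(x_i)_{i=0}^\infty$. Birkhoff sums: $f_n=\sum_{i=0}^{n-1}f\circ T^i$, and similarly $\hat f_n=\sum_{i=0}^{n-1}\hat f\circ\hat T^i$. Variations: for $g:X\to\mathbb R$, $\mathrm{var}_n g=\sup\{|g(x)-g(y)|:x_i=y_i\ \forall\,0\le i\le n-1\}$.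 For $\hat g:\hat X\to\mathbb R$, $\mathrm{var}_n\hat g=\sup\{|\hat g(\hat x)-\hat g(\hat y)|:x_i=y_i\ \forall\,-n+1\le i\le n-1\}$ and $\mathrm{var}_{[-k,n+k]}\hat g=\sup\{|\hat g(\hat x)-\hat g(\hat y)|:x_i=y_i\ \forall\,-k\le i\le n+k-1\}$. Walters condition, one-sided: $f\in C(X)$ with $\lim_{k\to\infty}\sup_{n\ge1}\mathrm{var}_{n+k}f_n=0$ and $\mathrm{var}_{n+k}f_n<\infty$ for all $k,n\ge1$. Walters condition, two-sided: $\hat f\in C(\hat X)$ with $\lim_{k\to\infty}\sup_{n\ge1}\mathrm{var}_{[-k,n+k]}\hat f_n=0$ and $\mathrm{var}_{[-k,n+k]}\hat f_n<\infty$ for all $k,n\ge1$. *)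

(* Defs.v *)
From HB Require Import structures.
From mathcomp Require Import all_boot all_order all_algebra.
From mathcomp Require Import all_classical all_reals all_analysis.

Set Implicit Arguments.
Unset Strict Implicit.
Unset Printing Implicit Defensive.

Import Order.TTheory GRing.Theory Num.Theory.
Import numFieldNormedType.Exports.

Local Open Scope classical_set_scope.
Local Open Scope ring_scope.

Section TopologicalMarkovShifts.
(* The 0-1 transition matrix is a boolean relation: [A a b] means A_ab = 1. *)
Variables (S : countType) (A : S -> S -> bool).

(* As subsets of products of copies of the discrete space [S]; coerced to types
   by [set_type], they carry the subspace topology of the product topology. *)
Definition tms1 : set (prod_topology (fun _ : nat => discrete_topology S)) :=
  [set x | forall i : nat, A (x i) (x i.+1)].

Definition tms2 : set (prod_topology (fun _ : int => discrete_topology S)) :=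
  [set x | forall i : int, A (x i) (x (i + 1))].

Lemma tms1_shift (x : tms1) : tms1 (fun i => set_val x i.+1).
Proof. by move=> i; exact: (set_mem (valP x)). Qed.

Lemma tms2_shift (x : tms2) : tms2 (fun i => set_val x (i + 1)).
Proof. by move=> i; exact: (set_mem (valP x)). Qed.

Lemma tms2_proj (x : tms2) : tms1 (fun i => set_val x i%:Z).
Proof. by move=> i; have := set_mem (valP x) i%:Z; rewrite -PoszD addn1. Qed.

Definition shift1 (x : tms1) : tms1 := SigSub (mem_set (tms1_shift x)).

Definition shift2 (x : tms2) : tms2 := SigSub (mem_set (tms2_shift x)).

Definition natproj (x : tms2) : tms1 := SigSub (mem_set (tms2_proj x)).

Definition agree1 (n : nat) (x y : tms1) : Prop :=
  forall i : nat, (i < n)%N -> set_val x i = set_val y i.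

Definition agree2 (a b : int) (x y : tms2) : Prop :=
  forall i : int, a <= i <= b -> set_val x i = set_val y i.

Definition differ2 (x y : tms2) (n : nat) : bool :=
  (set_val x n%:Z != set_val y n%:Z) ||
  (set_val x (- n%:Z) != set_val y (- n%:Z)).

(* exp (- min {|i| : x_i <> y_i}), with value 0 when x = y. *)
Definition dist2 (R : realType) (x y : tms2) : R :=
  match pselect (exists n, differ2 x y n) with
  | left ex => expR (- (ex_minn ex)%:R)
  | right _ => 0
  end.

Definition uniformly_continuous2 (R : realType) (h : tms2 -> R) : Prop :=
  forall e : R, 0 < e -> exists2 d : R, 0 < d &
    forall x y : tms2, dist2 R x y < d -> `|h x - h y| < e.

End TopologicalMarkovShifts.

Definition birkhoff (R : realType) (U : Type) (T : U -> U) (f : U -> R)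
    (n : nat) (x : U) : R :=
  \sum_(i < n) f (iter i T x).

(* sup {|g x - g y| : E x y}, a supremum in [0, +oo]: adjoining 0 only makes the
   supremum of the empty family 0 instead of -oo. *)
Definition osc (R : realType) (U : Type) (E : U -> U -> Prop) (g : U -> R) :
    \bar R :=
  ereal_sup ([set 0%E] `|`
    [set (`|g p.1 - g p.2|)%:E | p in [set p : U * U | E p.1 p.2]]).

Section Variations.
Variables (R : realType) (S : countType) (A : S -> S -> bool).

Definition var1 (n : nat) (g : tms1 A -> R) : \bar R := osc (agree1 n) g.

Definition var2 (n : nat) (g : tms2 A -> R) : \bar R :=
  osc (agree2 (- n%:Z + 1) (n%:Z - 1)) g.

(* var_[-k, m]; its right end m is excluded. *)
Definition var2_window (k m : nat) (g : tms2 A -> R) : \bar R :=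
  osc (agree2 (- k%:Z) (m%:Z - 1)) g.

Definition walters1 (f : tms1 A -> R) : Prop :=
  [/\ continuous f,
      (fun k : nat => ereal_sup
         [set var1 (n + k) (birkhoff (@shift1 S A) f n)
         | n in [set n : nat | (1 <= n)%N]]) @ \oo --> 0%E
    & forall k n : nat, (1 <= k)%N -> (1 <= n)%N ->
        (var1 (n + k) (birkhoff (@shift1 S A) f n) < +oo)%E].

Definition walters2 (f : tms2 A -> R) : Prop :=
  [/\ continuous f,
      (fun k : nat => ereal_sup
         [set var2_window k (n + k) (birkhoff (@shift2 S A) f n)
         | n in [set n : nat | (1 <= n)%N]]) @ \oo --> 0%E
    & forall k n : nat, (1 <= k)%N -> (1 <= n)%N ->
        (var2_window k (n + k) (birkhoff (@shift2 S A) f n) < +oo)%E].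

End Variations.

(* Main.v *)
(* For each symbol fix a past leading to it, and let e(x) be the two-sided
   sequence with future x in X and the past chosen for x_0. If two points u, v
   of the two-sided shift have the same future, the Walters condition makes the
   sums fhat_n(u) - fhat_n(v) converge, uniformly in u, v, to a limit D(u, v):
   the n-th shifts agree on [-n, oo), so the tails are uniformly small.
   Put h(u) = D(e(pi u), u). Since D is additive and
   D(u, v) = fhat(u) - fhat(v) + D(T u, T v), one gets
   fhat + h - h o T = fhat(e x) + D(T (e x), e(T x)) at every u over x = pi u.
   The Walters bounds for the resulting f on X follow from
   f_n(pi u) = fhat_n(u) + h(u) - h(T^n u) at u = e x, because e(x) and e(y)
   share their past as soon as x_0 = y_0. *)
Require Import Defs.
From HB Require Import structures.
From mathcomp Require Import all_boot all_order all_algebra.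
From mathcomp Require Import all_classical all_reals all_analysis.
From mathcomp Require Import zify lra.

Set Implicit Arguments.
Unset Strict Implicit.
Unset Printing Implicit Defensive.

Import Order.TTheory GRing.Theory Num.Theory.
Import numFieldNormedType.Exports.

Local Open Scope classical_set_scope.
Local Open Scope ring_scope.

(** * Birkhoff sums as a cocycle *)

Section Birkhoff.
Variables (R : realType) (U : Type) (T : U -> U).
Implicit Type f : U -> R.

Lemma birkhoff0 f x : birkhoff T f 0 x = 0.
Proof. by rewrite /birkhoff big_ord0. Qed.

Lemma birkhoffS f n x : birkhoff T f n.+1 x = f x + birkhoff T f n (T x).
Proof.
rewrite /birkhoff big_ord_recl; congr (_ + _).
by apply: eq_bigr => i _; rewrite -iterSr.
Qed.

Lemma birkhoffD f m n x :
  birkhoff T f (m + n) x = birkhoff T f m x + birkhoff T f n (iter m T x).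
Proof.
rewrite /birkhoff big_split_ord; congr (_ + _).
by apply: eq_bigr => i _; rewrite -iterD [(i + m)%N]addnC.
Qed.

Lemma birkhoff_dist_le f (c : R) n x y :
  (forall i, (i < n)%N -> `|f (iter i T x) - f (iter i T y)| <= c) ->
  `|birkhoff T f n x - birkhoff T f n y| <= c *+ n.
Proof.
move=> fc; rewrite /birkhoff -sumrB; apply: (le_trans (ler_norm_sum _ _ _)).
by rewrite -[n in c *+ n]card_ord -sumr_const; apply: ler_sum => i _; exact: fc.
Qed.

End Birkhoff.

(** * Passing between oscillations in the extended reals and real bounds *)

Section Oscillation.
Variables (R : realType) (U : Type) (E : U -> U -> Prop) (g : U -> R).

Lemma osc_ge0 : (0 <= osc E g)%E.
Proof. by apply: ereal_sup_ubound; left. Qed.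

Lemma le_osc x y : E x y -> ((`|g x - g y|)%:E <= osc E g)%E.
Proof. by move=> Exy; apply: ereal_sup_ubound; right; exists (x, y). Qed.

Lemma osc_le (c : R) : 0 <= c -> (forall x y, E x y -> `|g x - g y| <= c) ->
  (osc E g <= c%:E)%E.
Proof.
move=> c0 gc; apply: ge_ereal_sup => _ [->|[[x y] /= Exy <-]].
  by rewrite lee_fin.
by rewrite lee_fin gc.
Qed.

Lemma osc_bounded : (osc E g < +oo)%E ->
  exists2 c : R, 0 <= c & forall x y, E x y -> `|g x - g y| <= c.
Proof.
move=> oscoo; have fo : osc E g \is a fin_num.
  by rewrite ge0_fin_numE ?osc_ge0.
exists (fine (osc E g)); first by rewrite fine_ge0 ?osc_ge0.
by move=> x y Exy; rewrite -lee_fin fineK // le_osc.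
Qed.

End Oscillation.

Lemma ge0_cvge0P (R : realType) (u : nat -> \bar R) :
  (forall k, 0 <= u k)%E ->
  u @ \oo --> 0%E <->
  forall e : R, 0 < e -> \forall k \near \oo, (u k <= e%:E)%E.
Proof.
move=> u0; split=> [cu e e0|ue B].
  apply: (cu [set y | (y <= e%:E)%E]); rewrite /= /nbhs /= /ereal_nbhs.
  apply: filterS (nbhsx_ballx (0 : R) e e0) => r /=.
  rewrite /ball /= sub0r normrN lee_fin => /ltW.
  exact: le_trans (ler_norm _).
rewrite /= {1}/nbhs /= => /(@nbhs_ballP R R)[e /= e0 eB].
have e20 : 0 < e / 2 by rewrite divr_gt0.
apply: filterS (ue _ e20) => k /= uk; have := u0 k.
case: (u k) uk => [r| |] //=; rewrite !lee_fin => re r0; apply: eB.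
rewrite /ball /= sub0r normrN ger0_norm //; apply: le_lt_trans re _.
by rewrite ltr_pdivrMr // ltr_pMr // ltr1n.
Qed.

(** * Cylinder criteria on the one-sided shift *)

Section OneSided.
Variables (R : realType) (S : countType) (A : S -> S -> bool).

Lemma nbhs_coord1 (x : tms1 A) i : nbhs x [set y | set_val x i = set_val y i].
Proof.
have : {for x, continuous
    (proj i \o (set_val : tms1 A -> prod_topology (fun=> discrete_topology S)))}.
  apply: continuous_comp; first exact: initial_continuous.
  exact: (proj_continuous (K := fun=> discrete_topology S)).
by apply; rewrite nbhs_principalE => _ ->.
Qed.

Lemma nbhs_agree1 (x : tms1 A) n : nbhs x [set y | agree1 n x y].
Proof.
elim: n => [|n IH]; first by apply: (@filterE _ _ (nbhs_filter x)) => y i.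
apply: (@filterS _ _ (nbhs_filter x)) (filterI IH (nbhs_coord1 x n)) => y [agr_n eq_n] i.
by rewrite ltnS leq_eqVlt => /predU1P[->|/agr_n].
Qed.

Lemma continuous_tms1 (f : tms1 A -> R) :
  (forall e : R, 0 < e ->
     exists n, forall x y, agree1 n x y -> `|f x - f y| <= e) ->
  continuous f.
Proof.
move=> fe x; apply: (@cvgrPdist_le _ _ _ _ (nbhs_filter x) _ _).2 => e /fe[n fn].
by apply: (@filterS _ _ (nbhs_filter x)) (nbhs_agree1 x n) => y; exact: fn.
Qed.

(** Continuity is the case n = 1 of the uniform estimate. Agreement on n + k coordinates contains
    agreement on n, so the bounds of the second hypothesis give finiteness for every k. *)
Lemma walters1_bound (f : tms1 A -> R) :
  (forall e : R, 0 < e -> exists K, forall k n x y, (K <= k)%N ->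
     agree1 (n + k) x y ->
     `|birkhoff (@shift1 S A) f n x - birkhoff (@shift1 S A) f n y| <= e) ->
  (forall n, exists2 c : R, 0 <= c & forall x y, agree1 n x y ->
     `|birkhoff (@shift1 S A) f n x - birkhoff (@shift1 S A) f n y| <= c) ->
  walters1 f.
Proof.
move=> fe fc; split.
- apply: continuous_tms1 => e /fe[K fK]; exists (1 + K)%N => x y xy.
  by have := fK K 1%N x y (leqnn _) xy; rewrite !birkhoffS !birkhoff0 !addr0.
- have ge0 k : (0 <= ereal_sup [set var1 (n + k)
      (birkhoff (@shift1 S A) f n) | n in [set n : nat | (1 <= n)%N]])%E.
    apply: (le_trans (osc_ge0 (agree1 (1 + k)) (birkhoff (@shift1 S A) f 1))).
    by apply: ereal_sup_ubound; exists 1%N.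
  apply/(ge0_cvge0P ge0) => e e0; have [K fK] := fe e e0.
  exists K => // k /= Kk; apply: ge_ereal_sup => _ [n _ <-].
  by apply: osc_le => [|x y]; [exact: ltW|exact: fK].
- move=> k n k1 n1; have [c c0 fnc] := fc n.
  apply: (le_lt_trans _ (ltry c)); apply: osc_le => // x y xy.
  by apply: fnc => i ilt; apply: xy; rewrite ltn_addr.
Qed.

End OneSided.

(** * Two-sided shift: Walters estimates, the metric, and the choice of pasts *)

Section TwoSided.
Variables (R : realType) (S : countType) (A : S -> S -> bool).
Implicit Types (x y z : tms2 A) (f : tms2 A -> R).

Lemma tms1_ext (x y : tms1 A) : (forall i, set_val x i = set_val y i) -> x = y.
Proof. by move=> xy; apply: val_inj; apply: funext. Qed.

Lemma iter_shift2 n x i :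
  set_val (iter n (@shift2 S A) x) i = set_val x (i + n%:Z).
Proof.
elim: n i => [|n IH] i; first by rewrite addr0.
by rewrite -addn1 addnC PoszD addrA -IH.
Qed.

Lemma natproj_shift x : natproj (shift2 x) = shift1 (natproj x).
Proof.
apply: tms1_ext => i; have -> : set_val (natproj (shift2 x)) i =
  set_val x (i%:Z + 1) by [].
by rewrite -PoszD addn1.
Qed.

Lemma walters2_bound f : walters2 f ->
  forall e : R, 0 < e -> exists K, forall k n x y, (K <= k)%N ->
    agree2 (- k%:Z) ((n + k)%:Z - 1) x y ->
    `|birkhoff (@shift2 S A) f n x - birkhoff (@shift2 S A) f n y| <= e.
Proof.
move=> [_ fW _] e e0.
have ge0 k : (0 <= ereal_sup [set var2_window k (n + k)
    (birkhoff (@shift2 S A) f n) | n in [set n : nat | (1 <= n)%N]])%E.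
  apply: (le_trans (osc_ge0 (agree2 (- k%:Z) ((1 + k)%:Z - 1))
    (birkhoff (@shift2 S A) f 1))).
  by apply: ereal_sup_ubound; exists 1%N.
have [K _ fK] := (ge0_cvge0P ge0).1 fW e e0.
(* The supremum only covers n >= 1; the empty sum is treated apart. *)
exists K => k [|n] x y Kk xy; first by rewrite !birkhoff0 subrr normr0 ltW.
rewrite -lee_fin; apply: le_trans (fK k Kk).
apply: (le_trans (le_osc (birkhoff (@shift2 S A) f n.+1) xy)).
by apply: ereal_sup_ubound; exists n.+1.
Qed.

Lemma var2_1_bound f : (var2 1 f < +oo)%E -> exists2 c : R, 0 <= c &
  forall x y, set_val x 0 = set_val y 0 -> `|f x - f y| <= c.
Proof.
move=> /osc_bounded[c c0 fc]; exists c => // x y xy0; apply: fc => i.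
(* The window of [var2 1] is [-1 + 1, 1 - 1], the single coordinate 0. *)
by rewrite -eq_le => /eqP <-.
Qed.

(** A disagreement at some i with |i| <= N makes the minimum in [dist2] at most N, hence the
    distance at least exp(-N). *)
Lemma dist2_agree2 N x y : dist2 R x y < expR (- N%:R) ->
  agree2 (- N%:Z) N%:Z x y.
Proof.
have dif i : set_val x i != set_val y i -> differ2 x y `|i|%N.
  by case: i => n xyi; apply/orP; [left|right].
rewrite /dist2; case: pselect => [ex|nex] dN i iN; last first.
  by apply/eqP/contraT => /dif xyi; case: nex; exists `|i|%N.
apply/eqP/contraT => /dif xyi; move: dN; case: ex_minnP => m _ mmin.
suff mN : (m <= N)%N by rewrite ltNge ler_expR lerN2 ler_nat mN.
by apply: (leq_trans (mmin _ xyi)); move: iN; lia.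
Qed.

Lemma glue_past z (x : tms1 A) : set_val z 0 = set_val x 0%N ->
  exists w : tms2 A, natproj w = x /\
    forall i : int, i <= 0 -> set_val w i = set_val z i.
Proof.
move=> zx; pose w i := if i is Posz n then set_val x n else set_val z i.
have zA : forall i, A (set_val z i) (set_val z (i + 1)) := set_mem (valP z).
have wA : tms2 A w.
  case=> [n|[|n]].
  - by rewrite -PoszD addn1; exact: (set_mem (valP x)).
  (* [Negz 0] is -1: the only transition across the seam, admissible because z and x share the
     symbol at 0. *)
  - by have : A (set_val z (Negz 0)) (set_val z 0) := zA (Negz 0); rewrite zx.
  - by have := zA (Negz n.+1); have -> : Negz n.+1 + 1 = Negz n by lia.
exists (SigSub (mem_set wA)); split; first exact: tms1_ext.
by case=> [[|n]|n] //= _; rewrite zx.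
Qed.

(* [natproj] need not be onto: a symbol may have no infinite past. *)
Definition extendable (x : tms1 A) := exists z, set_val z 0 = set_val x 0%N.

Lemma extendable_natproj x : extendable (natproj x).
Proof. by exists x. Qed.

Lemma eq_extendable (x y : tms1 A) : set_val x 0%N = set_val y 0%N ->
  extendable x = extendable y.
Proof. by rewrite /extendable => ->. Qed.

(** The past is chosen from the symbol at 0 alone, so points sharing that symbol get the same past.
    The point [z0] is a default value where no past exists. *)
Lemma exists_extension z0 : exists e : tms1 A -> tms2 A,
  (forall x : tms1 A, extendable x -> natproj (e x) = x) /\
  (forall n (x y : tms1 A), (0 < n)%N -> extendable x -> agree1 n x y ->
     forall i : int, i < n%:Z -> set_val (e x) i = set_val (e y) i).
Proof.
have /choice[past pastP] : forall a, exists w : tms2 A,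
    (exists z : tms2 A, set_val z 0 = a) -> set_val w 0 = a.
  move=> a; have [[z za]|nz] := pselect (exists z : tms2 A, set_val z 0 = a).
    by exists z.
  by exists z0.
have /choice[e eP] : forall x : tms1 A, exists w : tms2 A, extendable x ->
    natproj w = x /\
    forall i : int, i <= 0 -> set_val w i = set_val (past (set_val x 0%N)) i.
  move=> x; have [xe|nx] := pselect (extendable x); last by exists z0.
  by have [w wP] := glue_past (pastP _ xe); exists w.
exists e; split => [x /eP[]//|n x y n0 xe xy i iltn].
have ye : extendable y by rewrite -(eq_extendable (xy _ n0)).
have [ex xpast] := eP x xe; have [ey ypast] := eP y ye.
have [i0|i0] := leP i 0; first by rewrite xpast // ypast // (xy _ n0).
case: i i0 iltn => // i _ iltn.
have -> : set_val (e x) i = set_val (natproj (e x)) i by [].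
have -> : set_val (e y) i = set_val (natproj (e y)) i by [].
by rewrite ex ey xy.
Qed.

End TwoSided.

(** * The limit D, the transfer function h and the one-sided function *)

Section Coboundary.
Variables (R : realType) (S : countType) (A : S -> S -> bool).
Variable f : tms2 A -> R.
Hypothesis f_walters : forall e : R, 0 < e ->
  exists K, forall k n x y, (K <= k)%N ->
    agree2 (- k%:Z) ((n + k)%:Z - 1) x y ->
    `|birkhoff (@shift2 S A) f n x - birkhoff (@shift2 S A) f n y| <= e.
Implicit Types x y z : tms2 A.

Local Notation F := (birkhoff (@shift2 S A) f).

Definition agree_future x y := forall i : int, 0 <= i -> set_val x i = set_val y i.

Lemma agree_future_natproj x y : natproj x = natproj y -> agree_future x y.
Proof.
move=> xy [i _|//].
have -> : set_val x i = set_val (natproj x) i by [].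
by rewrite xy.
Qed.

Lemma agree_future_shift x y :
  agree_future x y -> agree_future (shift2 x) (shift2 y).
Proof. by move=> xy i i0; apply: xy; rewrite addr_ge0. Qed.

(* Agreement on [0, oo) becomes agreement on [-k, oo) after k shifts, so the
   Walters condition makes the differences of Birkhoff sums a Cauchy sequence. *)
Lemma birkhoff_cauchy (e : R) : 0 < e -> exists K, forall k m x y,
  (K <= k <= m)%N -> agree_future x y ->
  `|(F k x - F k y) - (F m x - F m y)| <= e.
Proof.
move=> /f_walters[K fK]; exists K => k m x y /andP[Kk km] xy.
rewrite -(subnKC km) !birkhoffD.
set a := F k x; set b := F k y; set c := F _ _; set d := F _ (iter k _ y).
rewrite (_ : _ - _ = - (c - d)); last by lra.
rewrite normrN; apply: (fK k) => // i /andP[ki _].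
by rewrite !iter_shift2; apply: xy; move: ki; lia.
Qed.

(** The limit D(x, y); the sequence is known to converge when x and y have the same future. *)
Definition defect x y : R := limn (fun n => F n x - F n y).

Lemma cvg_defect x y : agree_future x y ->
  F n x - F n y @[n --> \oo] --> defect x y.
Proof.
move=> xy; apply: (@cauchy_cvg R); apply: cauchy_exP => e e0.
have [|K FK] := @birkhoff_cauchy (e / 2); first by rewrite divr_gt0.
exists (F K x - F K y), K => // m /= Km.
rewrite /ball /=; apply: (@le_lt_trans _ _ (e / 2)); last by lra.
by apply: FK => //; rewrite leqnn.
Qed.

Lemma defectP x y (l : R) : F n x - F n y @[n --> \oo] --> l -> defect x y = l.
Proof. exact: cvg_lim. Qed.

(** Let m tend to infinity in [birkhoff_cauchy]; K stays independent of the points. *)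
Lemma defect_approx (e : R) : 0 < e -> exists K, forall k x y, (K <= k)%N ->
  agree_future x y -> `|defect x y - (F k x - F k y)| <= e.
Proof.
move=> /birkhoff_cauchy[K FK]; exists K => k x y Kk xy.
rewrite distrC.
have cv : `|F k x - F k y - (F n x - F n y)| @[n --> \oo] -->
    `|F k x - F k y - defect x y|.
  by apply: cvg_norm; apply: cvgB; [exact: cvg_cst|exact: cvg_defect].
apply: (cvgr_to_le cv); exists k => // m /= km; apply: FK => //.
by rewrite Kk.
Qed.

Lemma defectD x y z : agree_future x y -> agree_future y z ->
  defect x z = defect x y + defect y z.
Proof.
move=> xy yz; apply: defectP.
rewrite (_ : (fun n => _) =
    (fun n => (F n x - F n y) + (F n y - F n z))).
  by apply: cvgD; exact: cvg_defect.
by apply: funext => n; rewrite addrA subrK.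
Qed.

Lemma defect_shift x y : agree_future x y ->
  defect x y = f x - f y + defect (shift2 x) (shift2 y).
Proof.
move=> xy; apply: defectP; rewrite -cvg_shiftS.
rewrite (_ : (fun n => _) =
    (fun n => (f x - f y) + (F n (shift2 x) - F n (shift2 y)))).
  by apply: cvgD; [exact: cvg_cst|apply/cvg_defect/agree_future_shift].
by apply: funext => n; rewrite !birkhoffS opprD addrACA.
Qed.

Variable e : tms1 A -> tms2 A.
Hypothesis eK : forall x : tms1 A, extendable x -> natproj (e x) = x.
Hypothesis e_agree : forall n (x y : tms1 A), (0 < n)%N -> extendable x ->
  agree1 n x y -> forall i : int, i < n%:Z -> set_val (e x) i = set_val (e y) i.

Definition transfer x := defect (e (natproj x)) x.

(* This is [f + transfer - transfer \o shift2] evaluated at [e x], where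
   [transfer (e x) = 0]. *)
Definition one_sided (x : tms1 A) : R :=
  if `[< extendable x >] then
    f (e x) + defect (shift2 (e x)) (e (shift1 x))
  else 0.

Lemma agree_future_extension x : agree_future (e (natproj x)) x.
Proof. by apply: agree_future_natproj; rewrite eK //; exact: extendable_natproj. Qed.

Lemma one_sided_natproj x :
  f x + transfer x - transfer (shift2 x) = one_sided (natproj x).
Proof.
have ex := agree_future_extension x.
have eTx := agree_future_extension (shift2 x).
rewrite /one_sided asboolT; last exact: extendable_natproj.
rewrite -natproj_shift /transfer (defect_shift ex).
set Tex := shift2 (e (natproj x)).
(* T(e(pi x)), e(pi(T x)) and T x share one future, so D adds along this chain and its last link
   cancels [transfer (shift2 x)]. *)
have Tex_eTx : agree_future Tex (e (natproj (shift2 x))).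
  by move=> i i0; rewrite eTx // (agree_future_shift ex).
by rewrite (defectD Tex_eTx eTx); lra.
Qed.

(** For one large k, D is within d/4 of the k-th difference at both points, and the Walters
    condition compares the two pairs of k-th sums, again within d/4 each. *)
Lemma transfer_agree2 (d : R) : 0 < d -> exists N, forall x y,
  agree2 (- N%:Z) N%:Z x y -> `|transfer x - transfer y| <= d.
Proof.
move=> d0; have d40 : 0 < d / 4 by rewrite divr_gt0.
have [K1 FK1] := defect_approx d40; have [K2 FK2] := f_walters d40.
(* The Walters estimate for sums of length k with margin k needs agreement on [-k, 2k - 1]. *)
pose k := maxn K1 K2; exists (k + k)%N => x y xy.
have exy : `|F k (e (natproj x)) - F k (e (natproj y))| <= d / 4.
  apply: (FK2 k k) => [|i ik]; first exact: leq_maxr.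
  apply: (@e_agree (k + k).+1) => //; first exact: extendable_natproj.
    by move=> j jk; apply: xy; move: jk; lia.
  by move: ik; lia.
have Fxy : `|F k x - F k y| <= d / 4.
  apply: (FK2 k k) => [|i ik]; first exact: leq_maxr.
  by apply: xy; move: ik; lia.
have dx := FK1 k _ _ (leq_maxl _ _) (agree_future_extension x).
have dy := FK1 k _ _ (leq_maxl _ _) (agree_future_extension y).
rewrite /transfer; move: exy Fxy dx dy; rewrite !ler_norml.
by move=> /andP[? ?] /andP[? ?] /andP[? ?] /andP[? ?]; apply/andP; split; lra.
Qed.

Lemma transfer_uniformly_continuous : uniformly_continuous2 transfer.
Proof.
move=> d d0; have d20 : 0 < d / 2 by rewrite divr_gt0.
have [N hN] := transfer_agree2 d20.
exists (expR (- N%:R)) => [|x y /dist2_agree2/hN]; first exact: expR_gt0.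
by move=> /le_lt_trans; apply; lra.
Qed.

Lemma birkhoff_one_sided n x : birkhoff (@shift1 S A) one_sided n (natproj x) =
  F n x + transfer x - transfer (iter n (@shift2 S A) x).
Proof.
elim: n x => [|n IH] x; first by rewrite !birkhoff0 add0r subrr.
rewrite !birkhoffS -natproj_shift IH -one_sided_natproj iterSr; lra.
Qed.

(* Off the extendable points, an open and closed set determined by the coordinate
   0, [one_sided] vanishes, so an orbit only contributes after it has entered. *)
Lemma one_sided_extendable_bound (c : R) (m N : nat) : 0 <= c ->
  (forall n (x y : tms1 A), (0 < n <= N)%N -> extendable x -> agree1 (n + m) x y ->
    `|birkhoff (@shift1 S A) one_sided n x -
      birkhoff (@shift1 S A) one_sided n y| <= c) ->
  forall n (x y : tms1 A), (n <= N)%N -> agree1 (n + m) x y ->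
    `|birkhoff (@shift1 S A) one_sided n x -
      birkhoff (@shift1 S A) one_sided n y| <= c.
Proof.
move=> c0 bound; elim=> [|n IH] x y nN xy; first by rewrite !birkhoff0 subrr normr0.
have [xe|xne] := pselect (extendable x); first exact: bound.
have yne : ~ extendable y by rewrite -(eq_extendable (xy _ _)).
rewrite !birkhoffS {1 3}/one_sided !asboolF // !add0r.
by apply: IH => [|i im]; [exact: ltnW|exact: xy].
Qed.

Variable V : R.
Hypothesis V_ge0 : 0 <= V.
Hypothesis f_le : forall x y, set_val x 0 = set_val y 0 -> `|f x - f y| <= V.

Lemma birkhoff_le n x y : (forall i : nat, (i < n)%N ->
  set_val x i%:Z = set_val y i%:Z) -> `|F n x - F n y| <= V *+ n.
Proof.
move=> xy; apply: birkhoff_dist_le => i iltn; apply: f_le.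
by rewrite !iter_shift2 add0r xy.
Qed.

(** D is within 1 of the K-th difference for one K valid at all points, and each of its K terms is
    at most V. *)
Lemma defect_bounded : exists2 M : R, 0 <= M &
  forall x y, agree_future x y -> `|defect x y| <= M.
Proof.
have [K FK] := defect_approx ltr01.
exists (1 + V *+ K) => [|x y xy]; first by rewrite addr_ge0 ?mulrn_wge0.
have dK := FK K x y (leqnn _) xy.
have VK : `|F K x - F K y| <= V *+ K by apply: birkhoff_le => i _; exact: xy.
by rewrite -(subrK (F K x - F K y) (defect x y)) (le_trans (ler_normD _ _)) ?lerD.
Qed.

Lemma transfer_bounded : exists2 M : R, 0 <= M & forall x, `|transfer x| <= M.
Proof.
have [M M0 dM] := defect_bounded.
by exists M => // x; apply: dM; exact: agree_future_extension.
Qed.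

Lemma one_sided_walters : walters1 one_sided.
Proof.
apply: walters1_bound => [d d0|n].
  have d30 : 0 < d / 3 by rewrite divr_gt0.
  have [K FK] := f_walters d30; have [N hN] := transfer_agree2 d30.
  (* After n shifts the extensions agree only at coordinates below k, so covering [-N, N] takes k >
     N. *)
  exists (maxn K N.+1) => k n x y; rewrite geq_max => /andP[Kk Nk].
  apply: (@one_sided_extendable_bound _ k n) => //; first exact: ltW.
  move=> {}n {}x {}y _ xe xy.
  have nk0 : (0 < n + k)%N by lia.
  have ye : extendable y by rewrite -(eq_extendable (xy _ nk0)).
  rewrite -(eK xe) -(eK ye) !birkhoff_one_sided.
  have exy := e_agree nk0 xe xy.
  have : `|F n (e x) - F n (e y)| <= d / 3.
    by apply: (FK k) => // i ik; apply: exy; move: ik; lia.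
  have : `|transfer (e x) - transfer (e y)| <= d / 3.
    by apply: hN => i iN; apply: exy; move: iN; lia.
  have : `|transfer (iter n (@shift2 S A) (e x)) -
      transfer (iter n (@shift2 S A) (e y))| <= d / 3.
    by apply: hN => i iN; rewrite !iter_shift2; apply: exy; move: iN; lia.
  rewrite !ler_norml.
  by move=> /andP[? ?] /andP[? ?] /andP[? ?]; apply/andP; split; lra.
(* V bounds each of the n terms of the sum, and M each of the four values of h. The bound must cover
   all lengths m <= n, since orbits may become extendable late. *)
have [M M0 hM] := transfer_bounded; pose c := V *+ n + 4 * M.
exists c => [|x y xy]; first by rewrite addr_ge0 ?mulr_ge0 ?mulrn_wge0.
apply: (@one_sided_extendable_bound c 0 n) => //; last by rewrite addn0.
  by rewrite addr_ge0 ?mulr_ge0 ?mulrn_wge0.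
move=> {x y xy} m x y /andP[m0 mn] xe; rewrite addn0 => xy.
have ye : extendable y by rewrite -(eq_extendable (xy _ m0)).
rewrite -(eK xe) -(eK ye) !birkhoff_one_sided.
have : `|F m (e x) - F m (e y)| <= V *+ m.
  by apply: birkhoff_le => i im; apply: (e_agree m0).
have : V *+ m <= V *+ n by rewrite ler_wpMn2l.
have := hM (e x); have := hM (e y).
have := hM (iter m (@shift2 S A) (e x)); have := hM (iter m (@shift2 S A) (e y)).
rewrite /c !ler_norml => /andP[? ?] /andP[? ?] /andP[? ?] /andP[? ?] ? /andP[? ?].
by apply/andP; split; lra.
Qed.

End Coboundary.

Theorem theorem3p1 (R : realType) (S : countType) (A : S -> S -> bool)
    (fhat : tms2 A -> R) (hW : walters2 fhat) (hvar : (var2 1 fhat < +oo)%E) :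
  exists (f : tms1 A -> R) (h : tms2 A -> R),
    [/\ walters1 f, bounded_fun h, uniformly_continuous2 h
      & forall x : tms2 A, fhat x + h x - h (shift2 x) = f (natproj x)].
Proof.
have [V V0 fV] := var2_1_bound hvar.
(* If the two-sided shift is empty, the one-sided one may still have points, so f = 0 must be
   checked to be Walters; the claims about h are vacuous. *)
have [[z0 _]|empty] := pselect (exists z : tms2 A, True); last first.
  exists (cst 0), (cst 0); split.
  - apply: walters1_bound => [e e0|n]; [exists 0%N => k n x y _ _|exists 0 => // x y _].
      by rewrite /birkhoff !big1 // subrr normr0 ltW.
    by rewrite /birkhoff !big1 // subrr normr0.
  - by exists 0; split => // M M0 x; case: empty; exists x.
  - by move=> e e0; exists 1 => // x; case: empty; exists x.
  - by move=> x; case: empty; exists x.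
have fW := walters2_bound hW.
have [e [eK eA]] := exists_extension z0.
exists (one_sided fhat e), (transfer fhat e); split.
- exact (one_sided_walters fW eK eA V0 fV).
- have [M M0 hM] := transfer_bounded fW eK V0 fV.
  exists M; split; first exact: ger0_real.
  by move=> M' MM' x _; apply: (le_trans (hM x)); exact: ltW.
- exact (transfer_uniformly_continuous fW eK eA).
- exact (one_sided_natproj fW eK).
Qed.
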